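(* If $G$ is a connected $K_4$-free graph of order $n$ and has minimum degree $\delta \ge 4$, then $$\operatorname{diam}(G) \le \frac{4}{7} n + O(1).$$ Furthermore, this is sharp up to the determination of the $O(1)$ term, which will depend on $n \pmod 4$ for $n$ large.
   Context: All graphs are finite and simple. The order of a graph is its number of vertices. $\operatorname{diam}(G)$ is the maximum distance between two vertices of $G$. $K_4$-free means that $G$ contains no complete graph on four vertices, i.e. its clique number satisfies $\omega(G)\le 3$. $O(1)$ denotes a quantity bounded by an absolute constant as $n\to\infty$.
   Formalization: The O(1) term cannot be determined by n (mod 4), since the maximum diameter is an integer and 16/7 is not; the formal statement says that for n large it is determined exactly by n (mod 7), and that it takes differing values on any two residue classes mod 4. *)

(* Defs.v *)
From mathcomp Require Import all_boot.
Set Implicit Arguments.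
Unset Strict Implicit.
Unset Printing Implicit Defensive.

Definition simple_graph (T : finType) (e : rel T) : Prop :=
  symmetric e /\ irreflexive e.

Definition connected_graph (T : finType) (e : rel T) : Prop :=
  forall x y : T, connect e x y.

Definition degree (T : finType) (e : rel T) (x : T) : nat :=
  #|[set y | e x y]|.

(* The neutral value #|T| exceeds every degree of a simple graph; for the
   graph without vertices the minimum degree is 0. *)
Definition min_degree (T : finType) (e : rel T) : nat :=
  \big[minn/#|T|]_(x : T) degree e x.

Definition clique (T : finType) (e : rel T) (A : {set T}) : bool :=
  [forall x in A, forall y in A, (x != y) ==> e x y].

Definition K4_free (T : finType) (e : rel T) : Prop :=
  forall A : {set T}, clique e A -> #|A| <> 4.

Definition walk_of_length (T : finType) (e : rel T) (x y : T) (k : nat) : bool :=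
  [exists p : k.-tuple T, path e x p && (last x p == y)].

(* The least length of a walk from x to y.  Vertices joined by a walk are
   joined by one of length less than #|T|, so the search range loses nothing;
   the value is #|T| when x and y lie in different components. *)
Definition dist (T : finType) (e : rel T) (x y : T) : nat :=
  find (walk_of_length e x y) (iota 0 #|T|).

Definition diam (T : finType) (e : rel T) : nat :=
  \max_(x : T) \max_(y : T) dist e x y.

Definition admissible (T : finType) (e : rel T) : Prop :=
  [/\ simple_graph e, connected_graph e, K4_free e & 4 <= min_degree e].

Definition is_max_diam (n d : nat) : Prop :=
  (exists (T : finType) (e : rel T),
     [/\ admissible e, #|T| = n & diam e = d]) /\
  (forall (T : finType) (e : rel T),
     admissible e -> #|T| = n -> diam e <= d).

(* Main.v *)
(* Split a graph into distance layers.  Every closed neighbourhood has at least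
   five vertices and lies in three consecutive layers, and K4-freeness upgrades
   this to at least seven vertices in any four consecutive layers, whence
   diam <= 4n/7 + O(1).

   For the sharpness, let f(n) be the maximum diameter.  A cut vertex with at
   least two neighbours on either side can be expanded into layers
   1, 2, 2, 2, 1, which adds 7 vertices and 4 to the diameter; starting from two
   octahedra sharing a vertex, and duplicating vertices to reach every order,
   this gives f(n) >= 4n/7 - O(1).  An extremal graph of large order has so few
   surplus vertices that somewhere its layer sizes are periodic, 1, 2, 2, 2, and
   the singleton layer is such a cut vertex; hence f(n+7) >= f(n) + 4 for large
   n.  As f(n) - 4n/7 is bounded and has denominator 7, it is eventually constant
   on each residue class modulo 7, and it separates these classes because f is
   integer-valued. *)
Require Import Defs.
From mathcomp Require Import all_boot all_order all_algebra.
From mathcomp Require Import zify lra.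
From Stdlib Require Import ClassicalEpsilon.
Set Implicit Arguments.
Unset Strict Implicit.
Unset Printing Implicit Defensive.
Import Order.TTheory GRing.Theory Num.Theory.

(** * Distances and level functions *)

Section Distance.
Variables (T : finType) (e : rel T).

Lemma walkP x y k :
  reflect (exists p, [/\ path e x p, last x p = y & size p = k])
          (walk_of_length e x y k).
Proof.
apply: (iffP existsP) => [[p /andP[xp /eqP lp]]|[p [xp lp /eqP sp]]].
  by exists p; rewrite size_tuple.
by exists (Tuple sp); rewrite xp lp eqxx.
Qed.

Lemma dist_walk x y : connect e x y -> walk_of_length e x y (dist e x y).
Proof.
move=> /connectP[p xp ->]; case/shortenP: xp => q xq uq _.
have sq : size q < #|T| by have := max_card (mem (x :: q)); rewrite (card_uniqP uq).
have hq : has (walk_of_length e x (last x q)) (iota 0 #|T|).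
  by apply/hasP; exists (size q); [rewrite mem_iota | apply/walkP; exists q].
have := nth_find 0 hq; rewrite nth_iota //.
by move: hq; rewrite has_find size_iota.
Qed.

Lemma dist_min x y k : walk_of_length e x y k -> dist e x y <= k.
Proof.
move=> xyk; rewrite leqNgt; apply/negP => ltk.
have ltT : k < #|T| by rewrite (leq_trans ltk) // -[leqRHS](size_iota 0) find_size.
by have := before_find 0 ltk; rewrite nth_iota // xyk.
Qed.

Lemma dist_le_diam x y : dist e x y <= diam e.
Proof.
exact: leq_trans (leq_bigmax y) (@leq_bigmax _ (fun x => \max_y dist e x y) x).
Qed.

(** Stands in for the distance from a root: it bounds the diameter from below, yet is easily carried
    through a change of the graph. For symmetric [e] one inequality gives both. *)
Definition lipschitz (l : T -> nat) := forall x y, e x y -> l y <= (l x).+1.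

Lemma lipschitz_path l x p :
  lipschitz l -> path e x p -> l (last x p) <= l x + size p.
Proof.
move=> lip; elim: p x => [|y p IHp] x /=; first by rewrite addn0.
by move=> /andP[/lip exy /IHp]; lia.
Qed.

Hypothesis conn : connected_graph e.

Lemma lipschitz_diam l x y : lipschitz l -> l y - l x <= diam e.
Proof.
move=> lip; have /walkP[p [xp lp sp]] := dist_walk (conn x y).
have := dist_le_diam x y.
by have := lipschitz_path lip xp; rewrite lp sp; lia.
Qed.

Lemma dist_lipschitz x : lipschitz (dist e x).
Proof.
move=> y z eyz; apply: dist_min => //.
have /walkP[p [xp lp sp]] := dist_walk (conn x y).
by apply/walkP; exists (rcons p z); rewrite rcons_path last_rcons size_rcons xp lp eyz sp.
Qed.

Lemma dist0 x : dist e x x = 0.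
Proof. by apply/eqP; rewrite -leqn0 dist_min //; apply/walkP; exists [::]. Qed.

Lemma diam_attained : 0 < #|T| -> exists x y, dist e x y = diam e.
Proof.
move=> T0; have [x dx] := @bigop.eq_bigmax T (fun x => \max_y dist e x y) T0.
by have [y dy] := @bigop.eq_bigmax T (dist e x) T0; exists x, y; rewrite /diam dx dy.
Qed.

(** Discrete intermediate values along a path from [x] to [y]. *)
Lemma level_inhabited l x y j :
  lipschitz l -> l x <= j <= l y -> exists z, l z = j.
Proof.
move=> lip; have /connectP[p xp ->] := conn x y.
elim: p x xp => [|z p IHp] x /=; first by exists x; lia.
move=> /andP[/lip exz /IHp IH].
have [->|lxj] := eqVneq j (l x); first by exists x.
by move=> ?; apply: IH; lia.
Qed.

End Distance.

(** * Minimum degree and cliques *)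

Section Admissible.
Variables (T : finType) (e : rel T).

Lemma min_degree_ge d :
  d <= min_degree e -> forall x, d <= degree e x.
Proof.
move=> le_d x; apply: leq_trans le_d _; rewrite /min_degree.
have: x \in index_enum T by rewrite mem_index_enum.
elim: (index_enum T) => // y s IHs; rewrite big_cons in_cons geq_min.
by case/predU1P=> [->|/IHs->]; rewrite ?leqnn ?orbT.
Qed.

Lemma min_degreeP d (x0 : T) :
  (forall x, d <= degree e x) -> d <= min_degree e.
Proof.
move=> le_d; rewrite /min_degree.
elim/big_ind: _ => [|m n dm dn|x _] //; last by rewrite leq_min dm.
exact: leq_trans (le_d x0) (max_card _).
Qed.

Lemma card_gt0_min_degree : 0 < min_degree e -> 0 < #|T|.
Proof.
case: (posnP #|T|) => // T0; rewrite /min_degree T0 big_pred0 // => x.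
by have := fintype0 x T0.
Qed.

(** A homomorphism is injective on a clique: two vertices with the same image would give a loop. *)
Lemma clique_hom (T' : finType) (e' : rel T') (h : T' -> T) (A : {set T'}) :
    irreflexive e -> {in A &, forall x y, e' x y -> e (h x) (h y)} ->
  clique e' A -> clique e (h @: A) /\ #|h @: A| = #|A|.
Proof.
move=> irr hom cA.
have adj x y : x \in A -> y \in A -> x != y -> e (h x) (h y).
  move=> xA yA xy; apply: hom => //.
  by move/forall_inP: cA => /(_ _ xA)/forall_inP/(_ _ yA)/implyP; apply.
have inj : {in A &, injective h}.
  move=> x y xA yA hxy; apply/eqP; apply: contraFT (irr (h x)) => xy.
  by rewrite [X in e _ X]hxy adj.
split; last exact: card_in_imset.
apply/forall_inP => _ /imsetP[x xA ->]; apply/forall_inP => _ /imsetP[y yA ->].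
by apply/implyP => hxy; apply: adj => //; apply: contra_neq hxy => ->.
Qed.

End Admissible.

(** A proper colouring is a homomorphism into the complete graph on [k] vertices. *)
Lemma clique_colour (T : finType) (e : rel T) (k : nat) (c : T -> nat)
    (A : {set T}) :
    {in A, forall x, c x < k} -> {in A &, forall x y, e x y -> c x != c y} ->
  clique e A -> #|A| <= k.
Proof.
case: k => [|k] ck col cA.
  by case: (set_0Vmem A) => [->|[x /ck//]]; rewrite cards0.
have irr : irreflexive (fun i j : 'I_k.+1 => i != j) by move=> i; rewrite eqxx.
have [|_ <-] := clique_hom (h := fun x => inord (c x)) irr _ cA.
  move=> x y xA yA exy; rewrite -val_eqE /= !inordK ?ck //; exact: col.
by rewrite -[leqRHS]card_ord max_card.
Qed.

(** * Layer sizes *)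

(** The cut vertex to be expanded: for Lipschitz [l], every edge that climbs past its level starts
    at [p]. Two neighbours on each side keep degree 4 once [p] is split. *)
Definition pinched (T : finType) (e : rel T) (l : T -> nat) (p : T) :=
  [/\ forall x, l x = l p -> x = p,
      2 <= #|[set y | e p y && (l y <= l p)]|
    & 2 <= #|[set y | e p y && (l p < l y)]|].

Section Layers.
Variables (T : finType) (e : rel T) (l : T -> nat).
Hypotheses (simple : simple_graph e) (K4f : K4_free e).
Hypotheses (deg4 : forall x, 4 <= degree e x) (lip : lipschitz e l).

Definition layer j := [set x | l x == j].
Notation a j := #|layer j|.

Lemma closed_nbhd_sub x j : l x = j.+1 ->
  x |: [set y | e x y] \subset layer j :|: layer j.+1 :|: layer j.+2.
Proof.
move=> lx; apply/subsetP => y; rewrite !inE => /predU1P[->|exy].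
  by rewrite lx eqxx orbT.
have := lip exy; rewrite simple.1 in exy; have := lip exy; lia.
Qed.

Lemma card_closed_nbhd x : 5 <= #|x |: [set y | e x y]|.
Proof. by rewrite cardsU1 inE simple.2 /= add1n ltnS deg4. Qed.

Lemma card_three_layers j :
  #|layer j :|: layer j.+1 :|: layer j.+2| <= a j + a j.+1 + a j.+2.
Proof.
by rewrite (leq_trans (leq_card_setU _ _)) // leq_add2r leq_card_setU.
Qed.

Lemma three_layers j : (exists x, l x = j.+1) -> 5 <= a j + a j.+1 + a j.+2.
Proof.
move=> [x lx]; rewrite (leq_trans _ (card_three_layers j)) //.
exact: leq_trans (card_closed_nbhd x) (subset_leq_card (closed_nbhd_sub lx)).
Qed.

(** The equality case of [three_layers]: a closed neighbourhood has at least five vertices, so it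
    fills the three layers. *)
Lemma tight_adjacent x y j : l x = j.+1 -> a j + a j.+1 + a j.+2 <= 5 ->
  j <= l y <= j.+2 -> y != x -> e x y.
Proof.
move=> lx le5 ly yx.
have : y \in x |: [set y | e x y].
  have /eqP-> : x |: [set y | e x y] == layer j :|: layer j.+1 :|: layer j.+2.
    rewrite eqEcard closed_nbhd_sub // (leq_trans (card_three_layers j)) //.
    exact: leq_trans le5 (card_closed_nbhd x).
  by rewrite !inE; lia.
by rewrite !inE (negPf yx).
Qed.

(* If four consecutive layers had at most six vertices, the outer two would be
   singletons and the middle two would have four vertices in total, all of them
   pairwise adjacent by the degree condition. *)
Lemma four_layers j : (forall i, j <= i <= j.+3 -> exists x, l x = i) ->
  7 <= a j + a j.+1 + a j.+2 + a j.+3.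
Proof.
move=> inh; rewrite leqNgt; apply/negP => lt7.
have t1 := three_layers (inh j.+1 ltac:(lia)).
have t2 := three_layers (inh j.+2 ltac:(lia)).
have a_gt0 i : j <= i <= j.+3 -> 0 < a i.
  by case/inh=> x <-; apply/card_gt0P; exists x; rewrite inE.
have a0 := a_gt0 j ltac:(lia); have a3 := a_gt0 j.+3 ltac:(lia).
apply: (K4f (A := layer j.+1 :|: layer j.+2)).
  apply/forall_inP => x xM; apply/forall_inP => y yM; apply/implyP => xy.
  rewrite eq_sym in xy; rewrite !inE in xM yM.
  case/orP: xM => /eqP lx; apply: (tight_adjacent lx _ _ xy); lia.
rewrite cardsU (_ : _ :&: _ = set0) ?cards0; first lia.
by apply/setP => x; rewrite !inE; lia.
Qed.

(** Double counting: a vertex lies in at most one of the layers. The offset [k] serves shifted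
    sums. *)
Lemma sum_layers k m : \sum_(0 <= j < m) a (k + j) <= #|T|.
Proof.
rewrite big_mkord; under eq_bigr => j _ do rewrite -sum1dep_card big_mkcond /=.
rewrite exchange_big -sum1_card leq_sum //= => x _.
rewrite -big_mkcond sum1dep_card /=; apply/card_le1_eqP => i j.
by rewrite !inE => /eqP-> /eqP/addnI/val_inj.
Qed.

Lemma layered_order D m : (forall i, i <= D -> exists x, l x = i) ->
  4 * m <= D.+1 -> 7 * m <= #|T|.
Proof.
move=> inh le_mD; apply: leq_trans (sum_layers 0 (4 * m)).
elim: m le_mD => // m IHm le_mD.
have -> : 4 * m.+1 = (4 * m).+4 by lia.
rewrite !big_nat_recr //= !add0n.
have := @four_layers (4 * m); move/(_ ltac:(move=> i ?; apply: inh; lia)).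
by have := IHm ltac:(lia); lia.
Qed.

Lemma pinch_of_layers j : a j = 2 -> a j.+1 = 1 -> a j.+2 = 2 ->
  exists p, pinched e l p.
Proof.
move=> a0 a1 a2; have /cards1P[p lp] : a j.+1 == 1 by apply/eqP.
have lp1 : l p = j.+1 by have := set11 p; rewrite -lp inE => /eqP.
have tight : a j + a j.+1 + a j.+2 <= 5 by rewrite a0 a1 a2.
exists p; split=> [x lx||].
- by apply/set1P; rewrite -lp inE lx lp1.
- rewrite -a0 subset_leq_card //; apply/subsetP => y; rewrite !inE => /eqP ly.
  have yp : y != p by apply/eqP => yp; move: ly; rewrite yp lp1; lia.
  by rewrite (tight_adjacent lp1 tight _ yp) ?lp1; lia.
- rewrite -a2 subset_leq_card //; apply/subsetP => y; rewrite !inE => /eqP ly.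
  have yp : y != p by apply/eqP => yp; move: ly; rewrite yp lp1; lia.
  by rewrite (tight_adjacent lp1 tight _ yp) ?lp1; lia.
Qed.

Let s j := a j + a j.+1 + a j.+2 + a j.+3.

(* Equal consecutive window sums make the layer sizes 4-periodic, and the
   triple sums leave only a rotation of 1, 2, 2, 2. *)
Lemma pinch_of_windows i : (forall j, i <= j <= i + 6 -> exists x, l x = j) ->
  s i = 7 -> s i.+1 = 7 -> s i.+2 = 7 -> s i.+3 = 7 ->
  exists p, pinched e l p.
Proof.
rewrite /s => inh s0 s1 s2 s3.
have t1 := three_layers (inh i.+1 ltac:(lia)).
have t2 := three_layers (inh i.+2 ltac:(lia)).
have t3 := three_layers (inh i.+3 ltac:(lia)).
have t4 := three_layers (inh i.+4 ltac:(lia)).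
have t5 := three_layers (inh i.+4.+1 ltac:(lia)).
(* A window of seven minus a triple of at least five leaves a layer of at most two, so exactly one
   of these four is a singleton. *)
have [?|[?|[?|?]]] : a i.+1 = 1 \/ a i.+2 = 1 \/ a i.+3 = 1 \/ a i.+4 = 1 by lia.
- by apply: (@pinch_of_layers i); lia.
- by apply: (@pinch_of_layers i.+1); lia.
- by apply: (@pinch_of_layers i.+2); lia.
- by apply: (@pinch_of_layers i.+3); lia.
Qed.

(** Each layer lies in at most four windows, so the window sums total at most [4 * #|T|]. Four
    consecutive windows sum to 28 only if all equal 7, which yields a pinch; otherwise each such
    group contributes at least 29, too much in total. *)
Lemma pinch_exists D m : (forall i, i <= D -> exists x, l x = i) ->
  4 * m + 2 <= D -> 4 * #|T| < 29 * m -> exists p, pinched e l p.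
Proof.
move=> inh le_mD lt_m.
have s_ge7 j : j < 4 * m -> 7 <= s j.
  by move=> lt_j; apply: four_layers => i ?; apply: inh; lia.
have le_sum : \sum_(0 <= j < 4 * m) s j <= 4 * #|T|.
  rewrite !big_split /=.
  have S0 : \sum_(0 <= j < 4 * m) a j <= #|T| := sum_layers 0 (4 * m).
  have S1 : \sum_(0 <= j < 4 * m) a j.+1 <= #|T| := sum_layers 1 (4 * m).
  have S2 : \sum_(0 <= j < 4 * m) a j.+2 <= #|T| := sum_layers 2 (4 * m).
  have S3 : \sum_(0 <= j < 4 * m) a j.+3 <= #|T| := sum_layers 3 (4 * m).
  have -> : 4 * #|T| = #|T| + #|T| + #|T| + #|T| by lia.
  by rewrite !leq_add.
suff : forall k, k <= m ->
    29 * k <= \sum_(0 <= j < 4 * k) s j \/ exists p, pinched e l p.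
  by case/(_ m (leqnn _)) => //; lia.
elim=> [|k IHk] lekm; first by left.
have [le_k|] := IHk (ltnW lekm); last by right.
have [le28|gt28] := leqP (s (4 * k) + s (4 * k).+1 + s (4 * k).+2 + s (4 * k).+3) 28.
  have := s_ge7 (4 * k) ltac:(lia); have := s_ge7 (4 * k).+1 ltac:(lia).
  have := s_ge7 (4 * k).+2 ltac:(lia); have := s_ge7 (4 * k).+3 ltac:(lia).
  move=> ? ? ? ?; right; apply: (@pinch_of_windows (4 * k)); try lia.
  by move=> j ?; apply: inh; lia.
left; have -> : 4 * k.+1 = (4 * k).+4 by lia.
by rewrite !big_nat_recr //=; lia.
Qed.

End Layers.

(** * Enlarging a graph *)

Lemma connected_to (T : finType) (e : rel T) (r : T) :
  symmetric e -> (forall x, connect e x r) -> connected_graph e.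
Proof.
move=> sym to_r x y; apply: connect_trans (to_r x) _.
by rewrite (sym_connect_sym sym).
Qed.

(** * Duplicating a vertex *)

Section Twin.
Variables (T : finType) (e : rel T) (v : T).

(** [None] becomes a copy of [v] with the same neighbours, not adjacent to [v] when [e] is
    irreflexive. *)
Definition twin_rel : rel (option T) := relpre (odflt v) e.

Lemma twin_admissible : admissible e -> admissible twin_rel.
Proof.
move=> [[sym irr] conn K4f deg].
have [deg4 symt] : (forall x, 4 <= degree e x) /\ symmetric twin_rel.
  by split; [exact: min_degree_ge | move=> x y; apply: sym].
split.
- by split=> // x; apply: irr.
- have lift x : connect twin_rel (Some x) (Some v).
    have /connectP[p xp ->] := conn x v.
    apply/connectP; exists (map Some p); last by rewrite last_map.
    by rewrite path_map.
  apply: (connected_to (r := Some v)) => // -[x|] //.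
  have /card_gt0P[w] := ltn_trans (isT : 0 < 3) (deg4 v).
  rewrite inE => evw; apply: connect_trans (lift w); exact: connect1.
- move=> A cA cardA.
  have [//|cB cardB] := clique_hom (h := odflt v) irr _ cA.
  by apply: (K4f _ cB); rewrite cardB.
- apply: (min_degreeP None) => x; apply: leq_trans (deg4 (odflt v x)) _.
  rewrite /degree -(card_imset _ Some_inj) subset_leq_card //.
  by apply/subsetP => w /imsetP[y]; rewrite !inE => exy ->.
Qed.

End Twin.

Lemma degree_ge_seq (T : finType) (e : rel T) (x : T) (s : seq T) :
  uniq s -> all (e x) s -> size s <= degree e x.
Proof.
move=> us /allP es; rewrite -(card_uniqP us) subset_leq_card //.
by apply/subsetP => y /es; rewrite inE.
Qed.

Lemma degree_ge_set (T : finType) (e : rel T) (x u w : T) (A : {set T}) :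
    u \notin A -> w \notin A -> u != w -> e x u -> e x w ->
    {in A, forall y, e x y} -> #|A|.+2 <= degree e x.
Proof.
move=> uA wA uw xu xw xA.
have -> : #|A|.+2 = #|u |: (w |: A)|.
  by rewrite !cardsU1 !inE (negPf uw) (negPf uA) wA.
rewrite subset_leq_card //; apply/subsetP => y; rewrite !inE.
by case/or3P=> [/eqP->|/eqP->|/xA].
Qed.

(** * Expanding a pinched vertex into layers 1, 2, 2, 2, 1 *)

Section Insertion.
Variables (T : finType) (e : rel T) (l : T -> nat) (p : T).

(* The new vertices, by level offset: {0, 1}, {2, 3}, {4, 5}, {6}; together with
   [p] at offset 0 and of colour 0, two of them are adjacent iff their colours
   differ and their offsets are at most one apart. *)
Definition goffset (i : nat) := i./2.+1.
Definition gcolour (i : nat) := nth 0 [:: 1; 2; 0; 0; 1; 2; 0] i.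
Definition gadj (i j : nat) :=
  [&& gcolour i != gcolour j, goffset i <= (goffset j).+1
    & goffset j <= (goffset i).+1].
Definition attach (x : T) (j : nat) :=
  (x == p) && (j < 2) || [&& e p x, l p < l x & j == 6].

(* [p] keeps its lower neighbours and hands the upper ones over to the new
   vertex 6. *)
Definition insert_rel : rel (T + 'I_7) := fun u w =>
  match u, w with
  | inl x, inl y => e x y && ((l x <= l p) == (l y <= l p))
  | inl x, inr j => attach x j
  | inr j, inl x => attach x j
  | inr i, inr j => gadj i j
  end.

(** The upper part moves up by 4 to make room for the offsets 1 to 4 of the new vertices. *)
Definition insert_level (u : T + 'I_7) :=
  match u with
  | inl x => if l x <= l p then l x else l x + 4
  | inr j => l p + goffset j
  end.

Hypotheses (adm : admissible e) (lip : lipschitz e l) (pin : pinched e l p).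

Let sym : symmetric e. Proof. by case: adm => -[]. Qed.
Let irr : irreflexive e. Proof. by case: adm => -[]. Qed.

Lemma gadjC i j : gadj i j = gadj j i.
Proof. by rewrite /gadj eq_sym; congr (_ && _); rewrite andbC. Qed.

Lemma insert_sym : symmetric insert_rel.
Proof.
move=> [x|i] [y|j] //=; last exact: gadjC.
by rewrite sym [in X in _ && X]eq_sym.
Qed.

Lemma insert_irr : irreflexive insert_rel.
Proof. by move=> [x|i] /=; rewrite ?irr // /gadj eqxx. Qed.

Let pin1 x : l x = l p -> x = p.
Proof. by case: pin => + _ _; apply. Qed.

(** Hence the only edges that [insert_rel] deletes are those from [p] upwards. *)
Lemma crossing x y : e x y -> l x <= l p < l y -> x = p.
Proof. by move=> exy lxy; apply: pin1; have := lip exy; lia. Qed.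

Lemma insert_lipschitz : lipschitz insert_rel insert_level.
Proof.
move=> [x|i] [y|j] /=.
- move=> /andP[/lip + /eqP].
  by have [lx|lx] := leqP (l x) (l p); have [ly|ly] := leqP (l y) (l p) => //; lia.
- rewrite /attach /goffset => /orP[/andP[/eqP->]|/and3P[epx lx /eqP->]].
    by rewrite leqnn; lia.
  by rewrite ifN -?ltnNge //=; lia.
- rewrite /attach /goffset => /orP[/andP[/eqP-> _]|/and3P[/lip epx lx /eqP->]].
    by rewrite leqnn; lia.
  by rewrite ifN -?ltnNge //=; lia.
- by case/and3P; lia.
Qed.

Lemma insert_connected : connected_graph insert_rel.
Proof.
have csym := sym_connect_sym insert_sym.
have cadj u w : insert_rel u w -> connect insert_rel u w by apply: connect1.
have step u w : insert_rel u w -> connect insert_rel w (inl p) ->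
  connect insert_rel u (inl p) by move=> /cadj; apply: connect_trans.
pose g k (lt_k : k < 7) : T + 'I_7 := inr (Ordinal lt_k).
have c0 : connect insert_rel (g 0 isT) (inl p).
  by apply: cadj; rewrite /= /attach eqxx.
have c1 : connect insert_rel (g 1 isT) (inl p).
  by apply: cadj; rewrite /= /attach eqxx.
have c2 : connect insert_rel (g 2 isT) (inl p) by apply: step c0.
have c3 : connect insert_rel (g 3 isT) (inl p) by apply: step c0.
have c4 : connect insert_rel (g 4 isT) (inl p) by apply: step c2.
have c5 : connect insert_rel (g 5 isT) (inl p) by apply: step c2.
have c6 : connect insert_rel (g 6 isT) (inl p) by apply: step c4.
apply: (connected_to (r := inl p) insert_sym) => -[x|[k lt_k]]; last first.
  by case: k lt_k => [|[|[|[|[|[|[|k]]]]]]] lt_k //;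
    [move: c0|move: c1|move: c2|move: c3|move: c4|move: c5|move: c6];
    congr connect; congr inr; apply: val_inj.
(* Follow an old path to [p]; a deleted edge from [p] up to [x] is replaced by a route through
   vertex 6. *)
have /connectP[q xq lq] : connect e x p by case: adm => _ conn _ _; apply: conn.
elim: q x xq lq => [|y q IHq] x /=; first by move=> _ ->.
move=> /andP[exy yq] lq; have cy := IHq y yq lq.
have [lx|lx] := leqP (l x) (l p); have [ly|ly] := leqP (l y) (l p).
- by apply: step cy; rewrite /= exy lx ly.
- by rewrite (crossing exy) ?lx.
- have eyx : e y x by rewrite sym.
  have epx : e p x by rewrite -(crossing eyx) ?ly.
  by apply: step c6; rewrite /= /attach epx lx orbT.
- by apply: step cy; rewrite /= exy !(leqNgt _ (l p)) lx ly.
Qed.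

(** A clique with a new vertex below 6 has no old vertex but [p], so three colours suffice. Any
    other clique maps into the old graph by sending vertex 6 to [p]. *)
Lemma insert_K4_free : K4_free insert_rel.
Proof.
move=> A cA cardA.
have adj u w : u \in A -> w \in A -> u != w -> insert_rel u w.
  by move=> uA wA; move/forall_inP: cA => /(_ _ uA)/forall_inP/(_ _ wA)/implyP.
have [/existsP[i /andP[iA lt_i]]|/existsPn no_i] :=
    boolP [exists i : 'I_7, (inr i \in A) && (i < 6)].
  pose c (u : T + 'I_7) := if u is inr j then gcolour j else 0.
  suff : #|A| <= 3 by rewrite cardA.
  apply: (clique_colour (c := c)) cA.
    by move=> [x|[[|[|[|[|[|[|[|j]]]]]]] lt_j]] _.
  have only_p x : inl x \in A -> x = p.
    move=> xA; have /= := adj _ _ xA iA isT; rewrite /attach.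
    by case/orP=> [/andP[/eqP]//|/and3P[_ _ /eqP i6]]; move: lt_i; rewrite i6.
  have pcol (j : 'I_7) : attach p j -> gcolour j != 0.
    rewrite /attach irr /= orbF => /andP[_].
    by case: j => -[|[|j]].
  move=> [x|j] [y|k] xA yA /=.
  - by rewrite (only_p x) // (only_p y) // irr.
  - by rewrite (only_p x) // eq_sym; apply: pcol.
  - by rewrite (only_p y) //; apply: pcol.
  - by case/and3P.
case: adm => _ _ K4f _; pose h (u : T + 'I_7) := if u is inl x then x else p.
have six j : inr j \in A -> j = 6 :> nat.
  by move=> jA; have := no_i j; rewrite jA /=; have := ltn_ord j; lia.
have [|cB cardB] := clique_hom (h := h) irr _ cA.
  move=> [x|j] [y|k] xA yA /=.
  - by case/andP.
  - by rewrite (six k) // /attach /= andbF andbT sym => /andP[].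
  - by rewrite (six j) // /attach /= andbF andbT => /andP[].
  - by rewrite (six j) // (six k).
by apply: (K4f _ cB); rewrite cardB.
Qed.

Let g k (lt_k : k < 7) : T + 'I_7 := inr (Ordinal lt_k).

Let inl_inj : injective (@inl T 'I_7). Proof. by move=> x y []. Qed.

Lemma insert_degree u : 4 <= degree insert_rel u.
Proof.
case: pin => _ low up; have deg4 := min_degree_ge (let: And4 _ _ _ d := adm in d).
case: u => [x|[k lt_k]].
  have [->|xp] := eqVneq x p.
    apply: leq_trans (@degree_ge_set _ _ _ (g (isT : 0 < 7)) (g (isT : 1 < 7))
      (inl @: [set y | e p y && (l y <= l p)]) _ _ _ _ _ _) => //=.
    - by rewrite card_imset.
    - by apply/imsetP => -[].
    - by apply/imsetP => -[].
    - by rewrite /attach eqxx.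
    - by rewrite /attach eqxx.
    by move=> w /imsetP[y]; rewrite inE => /andP[epy ly] -> /=; rewrite epy leqnn ly.
  (* Old neighbours of [x] inject into the new ones, vertex 6 replacing [p] if [x] lies above it. *)
  pose h y := if (y == p) && (l p < l x) then g (isT : 6 < 7) else inl y.
  have h_inj : injective h.
    move=> y z; rewrite /h.
    case: ifP => [/andP[/eqP-> _]|_]; case: ifP => [/andP[/eqP-> _]|_] //.
    exact: inl_inj.
  apply: leq_trans (deg4 x) _; rewrite /degree -(card_imset _ h_inj).
  rewrite subset_leq_card //; apply/subsetP => w /imsetP[y].
  rewrite inE => exy -> ; rewrite inE /h.
  case: ifPn => [/andP[/eqP yp lx]|].
    have epx : e p x by rewrite -yp sym.
    by rewrite /= /attach epx lx orbT.
  rewrite /= exy /=; have [lx|lx] := leqP (l x) (l p).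
    have lx' : l x < l p by rewrite ltn_neqAle lx andbT; apply: contraNneq xp => /pin1->.
    by rewrite (leq_trans (lip exy)).
  rewrite andbT => yp; apply/eqP; symmetry; apply/negbTE; rewrite -ltnNge ltnNge.
  apply: contraNN yp => ly; rewrite sym in exy.
  by rewrite (crossing exy) // ly lx.
have seq4 (s : seq (T + 'I_7)) : size s = 4 -> uniq s ->
    all (insert_rel (inr (Ordinal lt_k))) s ->
    4 <= degree insert_rel (inr (Ordinal lt_k)).
  by move=> s4 us es; have := degree_ge_seq us es; rewrite s4.
case: k lt_k seq4 => [|[|[|[|[|[|[|k]]]]]]] lt_k seq4 //.
- apply: (seq4 [:: inl p; g (isT : 1 < 7); g (isT : 2 < 7); g (isT : 3 < 7)]) => //.
  by rewrite /= /attach eqxx.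
- apply: (seq4 [:: inl p; g (isT : 0 < 7); g (isT : 2 < 7); g (isT : 3 < 7)]) => //.
  by rewrite /= /attach eqxx.
- exact: (seq4 [:: g (isT : 0 < 7); g (isT : 1 < 7); g (isT : 4 < 7); g (isT : 5 < 7)]).
- exact: (seq4 [:: g (isT : 0 < 7); g (isT : 1 < 7); g (isT : 4 < 7); g (isT : 5 < 7)]).
- exact: (seq4 [:: g (isT : 2 < 7); g (isT : 3 < 7); g (isT : 5 < 7); g (isT : 6 < 7)]).
- exact: (seq4 [:: g (isT : 2 < 7); g (isT : 3 < 7); g (isT : 4 < 7); g (isT : 6 < 7)]).
apply: leq_trans (@degree_ge_set _ _ _ (g (isT : 4 < 7)) (g (isT : 5 < 7))
  (inl @: [set y | e p y && (l p < l y)]) _ _ _ _ _ _) => //=.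
- by rewrite card_imset.
- by apply/imsetP => -[].
- by apply/imsetP => -[].
by move=> w /imsetP[y]; rewrite inE => /andP[epy ly] ->; rewrite /= /attach epy ly orbT.
Qed.

Lemma insert_admissible : admissible insert_rel.
Proof.
split; [exact: conj insert_sym insert_irr | exact: insert_connected |
        exact: insert_K4_free | exact: min_degreeP (inl p) insert_degree].
Qed.

(** This makes the insertion repeatable: the lower neighbours of [p] survive, and the new vertices 0
    and 1 are its upper ones. *)
Lemma insert_pinched : pinched insert_rel insert_level (inl p).
Proof.
have lp : insert_level (inl p) = l p by rewrite /= leqnn.
case: pin => _ low up; split; rewrite lp.
- move=> [x|j] /=; last by rewrite /goffset; lia.
  by case: leqP => lx lxp; [rewrite (pin1 lxp) | lia].
- apply: leq_trans low _; rewrite -(card_imset _ inl_inj) subset_leq_card //.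
  apply/subsetP => w /imsetP[y]; rewrite inE => /andP[epy ly] ->.
  by rewrite inE /= epy leqnn ly.
apply: (@leq_trans #|[set g (isT : 0 < 7); g (isT : 1 < 7)]|); first by rewrite cards2.
apply/subset_leq_card/subsetP => w; rewrite !inE => /orP[] /eqP->;
  by rewrite /= /attach eqxx /goffset; lia.
Qed.

End Insertion.

(** The level function certifies a diameter of at least [d], without computing distances. *)
Definition levelled (n d : nat) :=
  exists (T : finType) (e : rel T) (l : T -> nat) (x y : T),
  [/\ admissible e, #|T| = n, lipschitz e l, l x = 0 & l y = d].

Definition pinched_levelled (n d : nat) :=
  exists (T : finType) (e : rel T) (l : T -> nat) (x y p : T),
  [/\ admissible e, #|T| = n, lipschitz e l, l x = 0 & l y = d] /\ 
  [/\ pinched e l p, l x <= l p & l p < l y].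

Lemma levelled_twin n d : levelled n d -> levelled n.+1 d.
Proof.
move=> [T [e [l [x [y [adm cT lip lx ly]]]]]].
exists (option T), (twin_rel e x), (l \o odflt x), (Some x), (Some y).
by split=> //; [exact: twin_admissible | rewrite card_option cT | move=> u w; apply: lip].
Qed.

Lemma pinched_levelled_insert n d :
  pinched_levelled n d -> pinched_levelled (n + 7) (d + 4).
Proof.
move=> [T [e [l [x [y [p [[adm cT lip lx ly] [pin lxp lpy]]]]]]]].
exists (T + 'I_7)%type, (insert_rel e l p), (insert_level l p), (inl x), (inl y), (inl p).
split; split=> /=.
- exact: insert_admissible.
- by rewrite card_sum cT card_ord.
- exact: insert_lipschitz.
- by rewrite lxp.
- by rewrite leqNgt lpy /= ly.
- exact: insert_pinched.
- by rewrite lxp leqnn.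
- by rewrite leqnn (leqNgt (l y)) lpy /=; lia.
Qed.

(* Two octahedra sharing the vertex 5. *)
Definition base_rel : rel 'I_11 := fun i j =>
  ((i <= 5) && (j <= 5) || (5 <= i) && (5 <= j)) && (i %% 3 != j %% 3).

Lemma base_admissible : admissible base_rel.
Proof.
have sym : symmetric base_rel.
  by move=> i j; rewrite /base_rel eq_sym [(j <= 5) && _]andbC [(4 < j) && _]andbC.
split.
- by split=> // i; rewrite /base_rel eqxx andbF.
- pose g k (lt_k : k < 11) : 'I_11 := Ordinal lt_k.
  have step i j : base_rel i j -> connect base_rel j (g 5 isT) ->
    connect base_rel i (g 5 isT) by move/connect1; apply: connect_trans.
  apply: (connected_to (r := g 5 isT) sym) => i.
  case: (boolP (base_rel i (g 5 isT))) => [/connect1//|].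
  (* What remains is 5 itself and its antipodes 2 and 8 in the two octahedra. *)
  case: i => -[|[|[|[|[|[|[|[|[|[|[|k]]]]]]]]]]] lt_k // _.
  + by apply: (step _ (g 0 isT)); last exact: connect1.
  + by rewrite (_ : Ordinal _ = g 5 isT) //; apply: val_inj.
  + by apply: (step _ (g 6 isT)); last exact: connect1.
- move=> A cA cardA; suff : #|A| <= 3 by rewrite cardA.
  apply: (clique_colour (c := fun i : 'I_11 => i %% 3)) cA.
    by move=> i _; rewrite ltn_mod.
  by move=> i j _ _ /andP[].
- apply: (min_degreeP ord0) => i.
  rewrite /degree cardE size_filter -enumT.
  have -> : count (mem [set j | base_rel i j]) (enum 'I_11) =
    count (fun j => ((i <= 5) && (j <= 5) || (5 <= i) && (5 <= j)) && (i %% 3 != j %% 3))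
      (iota 0 11).
    by rewrite -val_enum_ord count_map; apply: eq_count => j; rewrite /= inE.
  by case: i => -[|[|[|[|[|[|[|[|[|[|[|k]]]]]]]]]]] lt_k.
Qed.

Lemma base_pinched_levelled : pinched_levelled 11 2.
Proof.
pose g k (lt_k : k < 11) : 'I_11 := Ordinal lt_k.
exists 'I_11, base_rel, (fun i : 'I_11 => (5 <= i) + (5 < i)), (g 0 isT), (g 10 isT), (g 5 isT).
split; split=> //.
- exact: base_admissible.
- by rewrite card_ord.
- by move=> i j; rewrite /base_rel; lia.
- split.
  + by move=> i /= ?; apply: val_inj => /=; lia.
  + apply: (@leq_trans #|[set g 0 isT; g 1 isT]|); first by rewrite cards2.
    by apply/subset_leq_card/subsetP => w; rewrite !inE => /orP[] /eqP->.
  + apply: (@leq_trans #|[set g 6 isT; g 7 isT]|); first by rewrite cards2.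
    by apply/subset_leq_card/subsetP => w; rewrite !inE => /orP[] /eqP->.
Qed.

(** * The maximum diameter *)

Definition attained (n d : nat) := exists (T : finType) (e : rel T),
  [/\ admissible e, #|T| = n & diam e = d].

Lemma levelled_attained n d : levelled n d -> exists2 d', d <= d' & attained n d'.
Proof.
move=> [T [e [l [x [y [adm cT lip lx ly]]]]]]; exists (diam e); last by exists T, e.
by case: adm => _ conn _ _; have := lipschitz_diam conn x y lip; rewrite lx ly subn0.
Qed.

Lemma diametral_levels (T : finType) (e : rel T) : admissible e ->
  exists x y : T, [/\ lipschitz e (dist e x), dist e x x = 0, dist e x y = diam e
    & forall i, i <= diam e -> exists z, dist e x z = i].
Proof.
move=> [simple conn K4f deg].
have T_gt0 : 0 < #|T| by apply: (@card_gt0_min_degree _ e); apply: leq_trans deg.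
have [x [y dxy]] := diam_attained e T_gt0; exists x, y; split=> //.
- exact: dist_lipschitz.
- exact: dist0.
- move=> i le_i; apply: (@level_inhabited _ e conn _ x y); first exact: dist_lipschitz.
  by rewrite dist0 dxy.
Qed.

Lemma diam_upper (T : finType) (e : rel T) :
  admissible e -> 7 * diam e <= 4 * #|T| + 14.
Proof.
move=> adm; have [x [y [lip _ _ inh]]] := diametral_levels adm.
case: adm => simple _ K4f /min_degree_ge deg4.
(* Rounding [diam e + 1] down to a multiple of 4 loses at most 3, whence 14 = 7 * 2. *)
have := layered_order simple K4f deg4 lip (m := (diam e).+1 %/ 4) inh.
by move/(_ ltac:(lia)); lia.
Qed.

Lemma max_diam_exists n d : attained n d -> exists d', is_max_diam n d'.
Proof.
(* The search for a maximum needs a boolean predicate, obtained classically. *)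
move=> att; pose P k : bool := excluded_middle_informative (attained n k).
have PP k : reflect (attained n k) (P k) by apply: sumboolP.
have exP : exists k, P k by exists d; apply/PP.
have leP k : P k -> k <= 4 * n + 14.
  by move=> /PP[T [e [adm <- <-]]]; have := diam_upper adm; lia.
case: (ex_maxnP exP leP) => k /PP Pk max_k; exists k; split=> // T e adm cT.
by apply/max_k/PP; exists T, e.
Qed.

(** Apply [k] insertions to the base graph, then [r] duplications. *)
Lemma levelled_family k r : levelled (11 + 7 * k + r) (2 + 4 * k).
Proof.
elim: r => [|r IHr]; last by rewrite addnS; apply: levelled_twin.
rewrite addn0; suff [T [e [l [x [y [p [lev _]]]]]]] :
  pinched_levelled (11 + 7 * k) (2 + 4 * k) by exists T, e, l, x, y.
elim: k => [|k IHk]; first exact: base_pinched_levelled.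
have -> : 11 + 7 * k.+1 = 11 + 7 * k + 7 by lia.
by rewrite mulnSr addnA; apply: pinched_levelled_insert.
Qed.

Lemma diam_lower n d : 11 <= n -> is_max_diam n d -> 4 * n <= 7 * d + 54.
Proof.
move=> n_ge [_ max_d].
(* With [n = 11 + 7k + r] and [r <= 6], [4n] is at most [68 + 28k], which is [7 (2 + 4k) + 54]. *)
have := levelled_family ((n - 11) %/ 7) ((n - 11) %% 7).
have -> : 11 + 7 * ((n - 11) %/ 7) + (n - 11) %% 7 = n by lia.
move=> /levelled_attained[d' le_d' [T [e [adm cT de]]]].
by have := max_d _ _ adm cT; rewrite de; lia.
Qed.

Lemma max_diam_defined n : 11 <= n -> exists d, is_max_diam n d.
Proof.
move=> n_ge; have := levelled_family 0 (n - 11).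
rewrite muln0 addn0 subnKC // => /levelled_attained[d _].
exact: max_diam_exists.
Qed.

Lemma max_diam_step n d d' : 1000 <= n ->
  is_max_diam n d -> is_max_diam (n + 7) d' -> d + 4 <= d'.
Proof.
move=> n_ge max_d [_ max_d']; have low := @diam_lower n d ltac:(lia) max_d.
case: max_d => -[T [e [adm cT de]]] _.
have [x [y [lip lx ly inh]]] := diametral_levels adm.
have [p pin] : exists p, pinched e (dist e x) p.
  case: adm => simple _ K4f /min_degree_ge deg4.
  (* By the lower bound on the diameter, [29 * m] is about [29n / 7]; the excess [n / 7] over [4n]
     absorbs the rounding once [n >= 1000]. *)
  by apply: (pinch_exists simple K4f deg4 lip (m := (diam e - 2) %/ 4) inh); lia.
have ltp : dist e x p < dist e x y.
  case: pin => _ _ /ltnW/card_gt0P[z]; rewrite inE => /andP[_ ltz].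
  by rewrite ly; apply: leq_trans ltz (dist_le_diam _ _ _).
have : pinched_levelled n d.
  exists T, e, (dist e x), x, y, p.
  by split; split=> //; rewrite ?lx ?ly.
move=> /pinched_levelled_insert[T' [e' [l' [x' [y' [p' [lev _]]]]]]].
have [|d'' le_d'' [T'' [e'' [adm'' cT'' de'']]]] := @levelled_attained (n + 7) (d + 4).
  by exists T', e', l', x', y'.
by rewrite (leq_trans le_d'') // -de'' max_d'.
Qed.

(** Descent on the value at the starting point: if the sequence is not constant from there on,
    restart just after a strict drop. *)
Lemma nonincreasing_eventually_constant (S : nat -> nat) N0 :
    (forall n, N0 <= n -> S n.+1 <= S n) ->
  exists2 N, N0 <= N & forall n, N <= n -> S n.+1 = S n.
Proof.
move=> noninc; have [m le_m] := ubnP (S N0).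
elim: m N0 noninc le_m => [//|m IHm] N noninc lt_m.
have [const|nconst] := classic (forall n, N <= n -> S n.+1 = S n).
  by exists N.
have [n nconst_n] := not_all_ex_not _ _ nconst.
have [le_n neq_n] := imply_to_and _ _ nconst_n.
have mono k : S (N + k) <= S N.
  elim: k => [|k IHk]; first by rewrite addn0.
  by rewrite addnS (leq_trans (noninc _ (leq_addr _ _))).
have [||N' le_N' const] := IHm n.+1; last by exists N' => //; lia.
- by move=> k lt_k; apply: noninc; lia.
- by have := mono (n - N); rewrite subnKC // => ?; have := noninc n le_n; lia.
Qed.

(* The deficits [4 * n + 14 - 7 * f n] do not increase along a residue class
   modulo 7, so the sum of seven consecutive ones is eventually constant. *)
Lemma eventually_translation (f : nat -> nat) N0 :
    (forall n, N0 <= n -> f n + 4 <= f (n + 7)) ->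
    (forall n, N0 <= n -> 7 * f n <= 4 * n + 14) ->
  exists2 N, N0 <= N & forall n, N <= n -> f (n + 7) = f n + 4.
Proof.
move=> step up; pose h n := 4 * n + 14 - 7 * f n.
pose S n := \sum_(0 <= j < 7) h (n + j).
have S_succ n : S n.+1 + h n = S n + h (n + 7).
  by rewrite /S !big_nat_recr // !(big_geq (leqnn 0)) /= !addSn !addnS !addn0; lia.
have h_le n : N0 <= n -> h (n + 7) <= h n.
  by move=> le_n; have := step n le_n; rewrite /h; lia.
have [|N le_N S_const] := @nonincreasing_eventually_constant S N0.
  by move=> n le_n; have := S_succ n; have := h_le n le_n; lia.
exists N => // n le_n; have := S_succ n; rewrite S_const // => /addnI.
(* By [up] the subtractions in [h] are not truncated, so equal deficits give the translation. *)
by have := up n ltac:(lia); have := up (n + 7) ltac:(lia); rewrite /h; lia.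
Qed.

(** * Upper bound and sharpness *)

Local Open Scope ring_scope.

Theorem proposition5 :
  (exists C : rat, forall (n : nat) (T : finType) (e : rel T),
     simple_graph e -> connected_graph e -> K4_free e ->
     #|T| = n -> (4 <= min_degree e)%N ->
     (diam e)%:R <= 4 / 7 * n%:R + C)
  /\
  (exists (c : nat -> rat) (B : rat) (N : nat),
     [/\ forall n : nat, `|c n| <= B,
         forall n : nat, (N <= n)%N ->
           exists d : nat, is_max_diam n d /\ d%:R = 4 / 7 * n%:R + c n,
         forall n m : nat, (N <= n)%N -> (N <= m)%N ->
           (c n = c m <-> n = m %[mod 7])
       & forall r s : nat, (r < 4)%N -> (s < 4)%N -> r <> s ->
           forall M : nat, exists n m : nat,
             [/\ (M <= n)%N, (M <= m)%N, (n %% 4 = r)%N, (m %% 4 = s)%N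
               & c n <> c m]]).
Proof.
have natE a b : (a <= b)%N -> a%:R <= b%:R :> rat by rewrite ler_nat.
split.
  exists 2 => n T e simple conn K4f cT deg.
  have := @diam_upper T e ltac:(by split); rewrite cT => /natE.
  by rewrite natrD !natrM; lra.
pose f n := epsilon (inhabits 0%N) (is_max_diam n).
have fP n : (11 <= n)%N -> is_max_diam n (f n).
  by move=> /max_diam_defined; apply: epsilon_spec.
have f_up n : (11 <= n)%N -> (7 * f n <= 4 * n + 14)%N.
  by move=> /fP[[T [e [adm <- <-]]] _]; apply: diam_upper.
have [N le_N f_step] : exists2 N, (1000 <= N)%N &
    forall n, (N <= n)%N -> f (n + 7)%N = (f n + 4)%N.
  apply: eventually_translation => n le_n; last by apply: f_up; lia.
  by apply: (@max_diam_step n) => //; apply: fP; lia.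
have f_steps n k : (N <= n)%N -> f (n + 7 * k)%N = (f n + 4 * k)%N.
  move=> le_n; elim: k => [|k IHk]; first by rewrite !muln0 !addn0.
  have -> : (n + 7 * k.+1 = n + 7 * k + 7)%N by lia.
  rewrite f_step ?IHk; first lia.
  by rewrite (leq_trans le_n) ?leq_addr.
(* The value 0 below [N] keeps [c] bounded everywhere. *)
pose c n : rat := if (N <= n)%N then (f n)%:R - 4 / 7 * n%:R else 0.
have c_eq n m : (N <= n)%N -> (N <= m)%N -> (c n = c m <-> n = m %[mod 7]).
  rewrite /c => le_n le_m; rewrite le_n le_m; split=> [eq_c|].
    (* Clearing denominators, [7 (f n - f m) = 4 (n - m)], so 7 divides [n - m]. *)
    have /eqP : (7 * f n + 4 * m)%N%:R = (7 * f m + 4 * n)%N%:R :> rat.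
      by rewrite (natrD _ (7 * f n)) (natrD _ (7 * f m)) !natrM; lra.
    by rewrite eqr_nat => /eqP; lia.
  wlog le_nm : n m le_n le_m / (n <= m)%N.
    move=> gen; case: (leqP n m) => [|/ltnW] le_nm eq_nm; first exact: gen.
    by symmetry; apply: gen.
  move=> eq_nm; have -> : m = (n + 7 * ((m - n) %/ 7))%N by lia.
  by rewrite f_steps // (natrD _ (f n)) (natrD _ n) !natrM; lra.
(* From [N] on, [c n] lies between [-54/7] and 2. *)
exists c, 8, N; split=> //.
- move=> n; rewrite /c; case: ifP => le_n; last by rewrite normr0.
  have := natE _ _ (f_up n ltac:(lia)).
  have := natE _ _ (@diam_lower n (f n) ltac:(lia) (fP n ltac:(lia))).
  by rewrite ler_norml (natrD _ (4 * n)) (natrD _ (7 * f n)) !natrM; lra.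
- move=> n le_n; exists (f n); split; first by apply: fP; lia.
  by rewrite /c le_n; lra.
- move=> r s lt_r lt_s neq_rs M.
  (* Modulo both 4 and 7 the witnesses are [r] and [s], distinct and below 4. *)
  exists (28 * (M + N) + r)%N, (28 * (M + N) + s)%N; split; try lia.
  have eq_mod7 := c_eq (28 * (M + N) + r)%N (28 * (M + N) + s)%N.
  by move=> /eq_mod7; lia.
Qed.
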